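(* Let $\Bbbk$ be an algebraically closed field of characteristic $0$, let $X$ be an irreducible smooth affine algebraic variety over $\Bbbk$, $A=\Bbbk[X]$ and $\mathcal{V}=\mathrm{Der}_{\Bbbk}(A)$. Let $M$ be a finite $A\mathcal{V}$-module. Then $M$ is a projective $A$-module. In particular, \[ \{m\in M\mid \exists f\in A,\ f\neq0,\ \text{such that } fm=0\}=0. \]
   Context: An $A\mathcal{V}$-module is a $\Bbbk$-vector space $M$ that is both an $A$-module and a module over the Lie algebra $\mathcal{V}$, such that $\eta\cdot(f\cdot m)=\eta(f)\cdot m+f\cdot(\eta\cdot m)$ for all $\eta\in\mathcal{V}$, $f\in A$, $m\in M$. It is finite if it is finitely generated as an $A$-module. *)

(* Defs.v *)
From mathcomp Require Import all_boot all_order all_algebra.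
From mathcomp Require Import boolp classical_sets.
From mathcomp Require Import mpoly.
From mathcomp Require Import ring.

Set Implicit Arguments.
Unset Strict Implicit.
Unset Printing Implicit Defensive.

Import GRing.Theory.

Local Open Scope classical_set_scope.
Local Open Scope ring_scope.

Section AffineVarieties.
Variables (k : fieldType) (n : nat).
Implicit Types (p : {mpoly k[n]}) (x v : 'rV[k]_n) (X Y : set 'rV[k]_n).

Definition meval_pt p x : k := p.@[x ord0].

Definition zero_locus (S : set {mpoly k[n]}) : set 'rV[k]_n :=
  [set x | forall p, S p -> meval_pt p x = 0].

Definition vanishing_ideal X : set {mpoly k[n]} :=
  [set p | forall x, X x -> meval_pt p x = 0].

Definition zariski_closed X : Prop := exists S, X = zero_locus S.

(* For a closed X, the closed subsets of the subspace X are the closed subsets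
   of affine space contained in X. The empty set is not irreducible. *)
Definition irreducible_closed X : Prop :=
  [/\ zariski_closed X, X !=set0 &
      forall Y1 Y2, zariski_closed Y1 -> zariski_closed Y2 ->
        X = Y1 `|` Y2 -> X = Y1 \/ X = Y2].

Definition irreducible_chain X (d : nat) (Z : nat -> set 'rV[k]_n) : Prop :=
  (forall i, (i <= d)%N -> irreducible_closed (Z i) /\ Z i `<=` X) /\
  (forall i, (i < d)%N -> Z i `<` Z i.+1).

(* Krull dimension of X as a topological space. *)
Definition has_dimension X (d : nat) : Prop :=
  (exists Z, irreducible_chain X d Z) /\
  (forall e Z, irreducible_chain X e Z -> (e <= d)%N).

(* The Zariski tangent space at x, as the kernel of the Jacobian matrix of
   the whole ideal I(X), in coordinates of the ambient affine space. *)
Definition tangent_space X x : set 'rV[k]_n :=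
  [set v | forall p, vanishing_ideal X p ->
     \sum_(i < n) meval_pt p^`M(i) x * v ord0 i = 0].

(* Jacobian criterion as the definition of smoothness; it is the usual one
   for X irreducible, where the local dimension at every point is dim X. *)
Definition smooth X : Prop :=
  exists2 d, has_dimension X d &
    forall x, X x -> exists2 U : {vspace 'rV[k]_n},
      \dim U = d & forall v, v \in U <-> tangent_space X x v.

(* pi presents A as the ring k[x_1, ..., x_n] / I(X) of polynomial functions
   on X. *)
Definition is_coordinate_ring X (A : comAlgType k)
    (pi : {lrmorphism {mpoly k[n]} -> A}) : Prop :=
  (forall a, exists p, pi p = a) /\
  (forall p, pi p = 0 <-> vanishing_ideal X p).

End AffineVarieties.

Section Derivations.
Variables (k : fieldType) (A : comAlgType k).

Record derivation := Derivation {
  der_fun :> A -> A;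
  der_linear : forall (c : k) f g,
    der_fun (c *: f + g) = c *: der_fun f + der_fun g;
  der_leibniz : forall f g,
    der_fun (f * g) = der_fun f * g + f * der_fun g }.

Implicit Types (eta theta : derivation).

Lemma der_comb_linear (a : k) eta theta (c : k) f g :
  a *: eta (c *: f + g) + theta (c *: f + g) =
  c *: (a *: eta f + theta f) + (a *: eta g + theta g).
Proof.
by rewrite !der_linear !scalerDr !scalerA [c * a]mulrC addrACA.
Qed.

Lemma der_comb_leibniz (a : k) eta theta f g :
  a *: eta (f * g) + theta (f * g) =
  (a *: eta f + theta f) * g + f * (a *: eta g + theta g).
Proof.
by rewrite !der_leibniz scalerDr mulrDl mulrDr scalerAl scalerAr addrACA.
Qed.

(* The derivation a *: eta + theta. *)
Definition der_comb (a : k) eta theta : derivation :=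
  Derivation (der_comb_linear a eta theta) (der_comb_leibniz a eta theta).

Lemma der_bracket_linear eta theta (c : k) f g :
  eta (theta (c *: f + g)) - theta (eta (c *: f + g)) =
  c *: (eta (theta f) - theta (eta f)) + (eta (theta g) - theta (eta g)).
Proof. by rewrite !der_linear opprD addrACA scalerBr. Qed.

Lemma der_bracket_leibniz eta theta f g :
  eta (theta (f * g)) - theta (eta (f * g)) =
  (eta (theta f) - theta (eta f)) * g + f * (eta (theta g) - theta (eta g)).
Proof.
have dD (d : derivation) u v : d (u + v) = d u + d v.
  by rewrite -[u in LHS]scale1r der_linear scale1r.
rewrite !der_leibniz !dD !der_leibniz; ring.
Qed.

Definition der_bracket eta theta : derivation :=
  Derivation (der_bracket_linear eta theta) (der_bracket_leibniz eta theta).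

(* The k-vector space structure of M is the one induced by its A-module
   structure: c : k acts as c%:A. *)
Record is_AV_module (M : lmodType A) (act : derivation -> M -> M) : Prop := {
  act_linear : forall eta (c : k) m m',
    act eta (c%:A *: m + m') = c%:A *: act eta m + act eta m';
  act_der_linear : forall (c : k) eta theta m,
    act (der_comb c eta theta) m = c%:A *: act eta m + act theta m;
  act_bracket : forall eta theta m,
    act (der_bracket eta theta) m = act eta (act theta m) - act theta (act eta m);
  act_leibniz : forall eta (f : A) m,
    act eta (f *: m) = eta f *: m + f *: act eta m }.

End Derivations.

Section Modules.
Variables (A : comNzRingType) (M : lmodType A).

Definition finitely_generated : Prop :=
  exists s : seq M, forall m, exists c : 'I_(size s) -> A,
    m = \sum_(i < size s) c i *: s`_i.

Definition projective : Prop :=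
  forall (N N' : lmodType A) (g : {linear N -> N'}) (f : {linear M -> N'}),
    (forall y, exists x, g x = y) ->
    exists h : {linear M -> N}, forall m, g (h m) = f m.

End Modules.

(* Main.v *)
(** The ideal [I] of those [f] in [A] for which [f id_M] factors through a finite
    free module is stable under derivations, and it is nonzero because [M] is
    generically free. If [1] is in [I], then [M] has a finite dual basis, hence
    is projective and torsion-free. So it suffices that [A] has no proper
    nonzero ideal stable under derivations.

    Such an ideal vanishes at some point [x] of [X] by the Nullstellensatz. Since
    the rank of the conormal space is constant on [X], the Jacobian matrix
    yields derivations of [A] spanning the tangent space at [x], and from them an
    Euler field [theta] acting on [m^N / m^(N+1)] as [N], where [m] is the
    maximal ideal of [x]. In characteristic 0 this forces a stable ideal
    contained in [m] into every power of [m], hence to be zero by Krull's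
    intersection theorem. *)

Require Import Defs.
From HB Require Import structures.
From mathcomp Require Import all_boot all_order all_algebra.
From mathcomp Require Import boolp classical_sets.
From mathcomp Require Import mpoly.
From mathcomp Require Import ring zify.

Set Implicit Arguments.
Unset Strict Implicit.
Unset Printing Implicit Defensive.

Import GRing.Theory.

Local Open Scope classical_set_scope.
Local Open Scope ring_scope.

(** * Dual bases and the action on a finite module *)

Definition is_ideal (R : pzRingType) (I : set R) : Prop :=
  I 0 /\ forall a x y, I x -> I y -> I (a * x + y).

Section Ideals.
Variables (R : pzRingType) (I : set R).
Hypothesis idI : is_ideal I.

Lemma ideal0 : I 0. Proof. by case: idI. Qed.

Lemma idealD x y : I x -> I y -> I (x + y).
Proof. by move=> Ix Iy; rewrite -[x]mul1r; case: idI => _; apply. Qed.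

Lemma idealMl a x : I x -> I (a * x).
Proof. by move=> Ix; rewrite -[_ * _]addr0; case: idI => I0; apply. Qed.

Lemma idealN x : I x -> I (- x).
Proof. by move=> Ix; rewrite -mulN1r; apply: idealMl. Qed.

Lemma idealB x y : I x -> I y -> I (x - y).
Proof. by move=> Ix Iy; apply: idealD => //; apply: idealN. Qed.

Lemma ideal_sum (T : Type) (r : seq T) (P : pred T) (F : T -> R) :
  (forall i, P i -> I (F i)) -> I (\sum_(i <- r | P i) F i).
Proof.
by move=> IF; apply: big_ind => //; [exact: ideal0 | exact: idealD].
Qed.

End Ideals.

Section DualBases.
Variables (A : comNzRingType) (M : lmodType A).

Definition linear_form (phi : M -> A) : Prop :=
  forall a m m', phi (a *: m + m') = a * phi m + phi m'.

(* [f *: id] lies in the image of the canonical map from [M^* (x) M] to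
   [End M]; for [f = 1] this is the existence of a finite dual basis. *)
Definition factors_through_free (f : A) : Prop :=
  exists (T : finType) (phi : T -> M -> A) (e : T -> M),
    (forall i, linear_form (phi i)) /\
    forall m, f *: m = \sum_i phi i m *: e i.

Lemma linear_formD (phi : M -> A) m m' :
  linear_form phi -> phi (m + m') = phi m + phi m'.
Proof. by move=> lphi; rewrite -[m]scale1r lphi mul1r scale1r. Qed.

Lemma linear_form0 (phi : M -> A) : linear_form phi -> phi 0 = 0.
Proof. by move=> lphi; apply: (addrI (phi 0)); rewrite -linear_formD // !addr0. Qed.

Lemma linear_formZ (phi : M -> A) a m :
  linear_form phi -> phi (a *: m) = a * phi m.
Proof. by move=> lphi; rewrite -[a *: m]addr0 lphi linear_form0 // addr0. Qed.

(** Choosing preimages under [g] of the finitely many [f (e i)] determines the lift through the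
    forms [phi i]. *)
Lemma dual_basis_projective : factors_through_free 1 -> projective M.
Proof.
move=> [T [phi [e [lphi phiE]]]] N N' g f surj_g.
have /choice[x gx] : forall i, exists x, g x = f (e i) by move=> i; apply: surj_g.
pose h m := \sum_i phi i m *: x i.
have lin_h : linear h.
  move=> a m m'; rewrite /h scaler_sumr -big_split; apply: eq_bigr => i _ /=.
  by rewrite lphi scalerDl scalerA.
pose hL : {linear M -> N} := HB.pack h (GRing.isLinear.Build A M N *:%R h lin_h).
exists hL => m.
rewrite -[in RHS](scale1r m) phiE /= /h !linear_sum; apply: eq_bigr => i _.
by rewrite !linearZ gx.
Qed.

Lemma dual_basis_torsionfree (f : A) (m : M) :
  (forall a, f * a = 0 -> a = 0) ->
  factors_through_free 1 -> f *: m = 0 -> m = 0.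
Proof.
move=> regf [T [phi [e [lphi phiE]]]] fm0.
rewrite -[m]scale1r phiE big1 // => i _.
by rewrite [phi i m]regf ?scale0r // -linear_formZ // fm0 linear_form0.
Qed.

Lemma factors_through_free_ideal : is_ideal factors_through_free.
Proof.
split.
  exists 'I_0, (fun _ _ => 0), (fun _ => 0); split=> [i a m m'|m].
    by rewrite mulr0 addr0.
  by rewrite scale0r big_ord0.
move=> a x y [T [phi [e [lphi phiE]]]] [T' [phi' [e' [lphi' phiE']]]].
exists (T + T')%type.
exists (fun i m => match i with inl j => a * phi j m | inr j => phi' j m end).
exists (fun i => match i with inl j => e j | inr j => e' j end).
split=> [[i|i] b m m'|m].
- by rewrite lphi; ring.
- exact: lphi'.
rewrite big_sumType /= -phiE' scalerDl -scalerA phiE scaler_sumr.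
by congr (_ + _); apply: eq_bigr => i _; rewrite scalerA.
Qed.

Hypothesis domA : forall a b : A, a * b = 0 -> a = 0 \/ b = 0.

Lemma prod_neq0 (T : finType) (a : T -> A) :
  (forall i, a i != 0) -> \prod_i a i != 0.
Proof.
move=> a0; apply: (big_ind (fun x : A => x != 0)) => // [|x y x0 y0]; first exact: oner_neq0.
by apply/eqP => /domA[/eqP|/eqP]; apply/negP.
Qed.

(** Take a maximal independent subset [J] of the generators. Each generator has a nonzero multiple
    in the span of [J], so the product of these multipliers maps [M] into a free submodule, whose
    coordinates are linear by uniqueness. *)
Lemma finitely_generated_generically_free :
  finitely_generated M -> exists2 a : A, a != 0 & factors_through_free a.
Proof.
move=> [s gen_s]; set n := size s in gen_s.
pose indep (J : {set 'I_n}) := forall b : 'I_n -> A,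
  \sum_(i in J) b i *: s`_i = 0 -> forall i, i \in J -> b i = 0.
have indep0 : `[< indep finset.set0 >].
  by apply/asboolP => b _ i; rewrite inE.
have [J /asboolP indJ maxJ] :=
  arg_maxnP (P := fun J => `[< indep J >]) (fun J : {set 'I_n} => #|J|) indep0.
have /choice[a /all_and2[a0 /choice[c acE]]] : forall j : 'I_n, exists a : A,
    a != 0 /\ exists c, a *: s`_j = \sum_(i in J) c i *: s`_i.
  move=> j; have [jJ|jJ] := boolP (j \in J).
    exists 1; split; first exact: oner_neq0.
    exists (fun i => (i == j)%:R); rewrite (bigD1 j) //= eqxx big1 ?addr0 //.
    by move=> i /andP[_ /negPf->]; rewrite scale0r.
  (* Otherwise every relation on [j |: J] has coefficient 0 at [j], so this set is independent,
     against the maximality of [J]. *)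
  apply: contrapT => noa.
  suff ind : indep (j |: J).
    have /asboolP/maxJ := ind.
    by rewrite cardsU1 jJ add1n /= ltnn.
  move=> b; rewrite big_setU1 //= => bE.
  have bj0 : b j = 0.
    apply: contrapT => /eqP bj0; apply: noa; exists (b j); split=> //.
    exists (fun i => - b i); under eq_bigr do rewrite scaleNr.
    by rewrite sumrN; apply/eqP; rewrite -addr_eq0 bE.
  move=> i; rewrite !inE => /orP[/eqP->//|iJ].
  by apply: indJ => //; move: bE; rewrite bj0 scale0r add0r.
pose d := \prod_i a i.
have /choice[b bE] : forall m, exists b : 'I_n -> A,
    d *: m = \sum_(i in J) b i *: s`_i.
  move=> m; have [g ->] := gen_s m.
  (* The product over [l != j] is the cofactor that turns [a j] into [d]. *)
  exists (fun i => \sum_j (\prod_(l | l != j) a l) * g j * c j i).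
  under [RHS]eq_bigr do rewrite scaler_suml.
  rewrite exchange_big scaler_sumr; apply: eq_bigr => j _ /=.
  rewrite /d (bigD1 j) //= scalerA -mulrA mulrC -scalerA acE scaler_sumr.
  by apply: eq_bigr => i _; rewrite scalerA.
have uniqJ (u v : 'I_n -> A) :
    \sum_(i in J) u i *: s`_i = \sum_(i in J) v i *: s`_i ->
    forall i, i \in J -> u i = v i.
  move=> /eqP; rewrite -subr_eq0 -sumrB => /eqP uv0 i iJ.
  apply/eqP; rewrite -subr_eq0; apply/eqP; apply: (indJ (fun i => u i - v i)) => //.
  by rewrite -[RHS]uv0; apply: eq_bigr => l _; rewrite scalerBl.
exists d; first exact: prod_neq0.
exists 'I_n, (fun i m => if i \in J then b m i else 0), (fun i : 'I_n => s`_i).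
split=> [i x m m'|m]; last first.
  rewrite bE [RHS](bigID (mem J)) /= [X in _ + X]big1 ?addr0 => [|i /negPf->]; last first.
    by rewrite scale0r.
  by apply: eq_bigr => i ->.
case: ifP => iJ; last by rewrite mulr0 addr0.
apply: (uniqJ _ (fun i => x * b m i + b m' i)) => //.
rewrite -bE scalerDr scalerA mulrC -scalerA !bE scaler_sumr -big_split.
by apply: eq_bigr => l _; rewrite scalerDl scalerA.
Qed.

End DualBases.

Section AVModules.
Variables (k : fieldType) (A : comAlgType k) (M : lmodType A).
Variable act : derivation A -> M -> M.
Hypothesis M_AV : is_AV_module act.

Definition derivation_stable (I : set A) : Prop :=
  forall (eta : derivation A) f, I f -> I (eta f).

Lemma actD eta m m' : act eta (m + m') = act eta m + act eta m'.
Proof.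
have := act_linear M_AV eta 1 m m'.
by rewrite !scale1r.
Qed.

Lemma act0 eta : act eta 0 = 0.
Proof. by apply: (addrI (act eta 0)); rewrite -actD !addr0. Qed.

Lemma act_sum eta (T : finType) (F : T -> M) :
  act eta (\sum_i F i) = \sum_i act eta (F i).
Proof. by apply: big_morph => [m m'|]; [exact: actD | exact: act0]. Qed.

Lemma derD (eta : derivation A) f g : eta (f + g) = eta f + eta g.
Proof. by have := der_linear eta 1 f g; rewrite !scale1r. Qed.

(* The forms [m |-> eta (phi m) - phi (eta m)] are the action of [eta] on the
   dual module; applying [eta] to [f m = \sum phi_i(m) e_i] gives
   [eta(f) m = \sum (eta phi_i)(m) e_i + \sum phi_i(m) (eta e_i)]. *)
Lemma factors_through_free_stable :
  derivation_stable (@factors_through_free A M).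
Proof.
move=> eta f [T [phi [e [lphi phiE]]]].
exists (T + T)%type.
exists (fun i m => match i with
  | inl j => eta (phi j m) - phi j (act eta m) | inr j => phi j m end).
exists (fun i => match i with inl j => e j | inr j => act eta (e j) end).
split=> [[i|i] b m m'|m].
- rewrite lphi derD der_leibniz actD (act_leibniz M_AV) !linear_formD //.
  by rewrite !linear_formZ //; ring.
- exact: lphi.
rewrite big_sumType /=.
have E := act_leibniz M_AV eta f m.
rewrite phiE act_sum (phiE (act eta m)) in E.
apply: (addIr (\sum_i phi i (act eta m) *: e i)); rewrite -E -!big_split.
apply: eq_bigr => i _ /=.
by rewrite (act_leibniz M_AV) scalerBl addrAC subrK.
Qed.

End AVModules.

(** * The weak Nullstellensatz *)

Section ExtendPoint.
Variables (k : closedFieldType) (R : comNzRingType) (ev : {rmorphism R -> k}).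
Hypothesis ev_surj : forall c, exists r, ev r = c.

Lemma map_poly_surj (q : {poly k}) : exists p, map_poly ev p = q.
Proof.
have /choice[r rE] := ev_surj.
exists (\poly_(i < size q) r q`_i); apply/polyP => i.
rewrite coef_map coef_poly; case: ltnP => [_|/leq_sizeP/(_ i (leqnn i))->].
  exact: rE.
exact: rmorph0.
Qed.

Variables (K : set {poly R}) (f : {poly R}).
Hypotheses (idK : is_ideal K) (f_monic : f \is monic) (Kf : K f).
Hypothesis K_const : forall r, K r%:P -> ev r = 0.

(* Multiplication by [g] on the finite free [R]-module [R[X]/(f)] has a matrix
   specializing to the identity, so its determinant, which lies in [K], does
   not vanish under [ev]. *)
Lemma extend_point_proper (g : {poly R}) : K g -> map_poly ev g != 1.
Proof.
move=> Kg; apply/eqP => evg1; set e := (size f).-1.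
have szf : size f = e.+1.
  by rewrite prednK // lt0n size_poly_eq0 monic_neq0.
have szf' : size (map_poly ev f) = e.+1 by rewrite size_map_poly_id0 // (monicP f_monic) rmorph1 oner_neq0.
have f'_monic : map_poly ev f \is monic by exact: monic_map.
(* In degree 0 the monic [f] would be 1, and [K_const] would give [ev 1 = 0]. *)
have e_gt0 : (0 < e)%N.
  rewrite lt0n; apply/eqP => e0.
  have f1 : f = 1.
    have /size1_polyC fE : (size f <= 1)%N by rewrite szf e0.
    by move/monicP: f_monic; rewrite fE lead_coefC => ->.
  have /eqP : ev 1 = 0 by apply: K_const; rewrite -[1%:P]f1.
  by rewrite rmorph1 oner_eq0.
pose r (i : nat) := Pdiv.Ring.rmodp ('X^i * g) f.
have Kr i : K (r i).
  have /(canLR (addKr _)) := Pdiv.RingMonic.rdivp_eq f_monic ('X^i * g).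
  rewrite -/(r i) => <-; apply: idealD => //; last exact: idealMl.
  by apply/(idealN idK)/(idealMl idK).
have szr i : (size (r i) <= e)%N.
  by rewrite -ltnS -szf Pdiv.Ring.ltn_rmodp monic_neq0.
have evr i : (i < e)%N -> map_poly ev (r i) = 'X^i.
  move=> lt_ie.
  have Xi : 'X^i = map_poly ev ('X^i * g).
    by rewrite rmorphM /= evg1 mulr1 map_polyXn.
  have := Pdiv.RingMonic.rdivp_eq f_monic ('X^i * g).
  move/(congr1 (map_poly ev)); rewrite -Xi rmorphD rmorphM /= -/(r i) => XiE.
  have := Pdiv.Ring.rmodp_small (p := 'X^i) (q := map_poly ev f).
  rewrite size_polyXn szf' ltnS => /(_ lt_ie) <-.
  rewrite XiE Pdiv.RingMonic.rmodp_addl_mul_small // szf' ltnS.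
  exact: leq_trans (size_poly _ _) (szr i).
pose M : 'M[R]_e := \matrix_(i, j) (r i)`_j.
have evM : map_mx ev M = 1%:M.
  apply/matrixP => i j; rewrite !mxE -coef_map evr // coefXn.
  by rewrite eq_sym.
pose M' := map_mx polyC M.
pose v : 'cV[{poly R}]_e := \col_j 'X^j.
have M'v i : (M' *m v) i 0 = r i.
  rewrite mxE -[RHS](@coefK _ (r i)) poly_def (big_ord_widen e (fun j => (r i)`_j *: 'X^j)) //.
  rewrite [RHS]big_mkcond; apply: eq_bigr => j _; rewrite !mxE mul_polyC.
  by case: ltnP => // /leq_sizeP/(_ j (leqnn j))->; rewrite scale0r.
have : K (\det M)%:P.
  (* Cramer's rule, read at the entry of [v] equal to ['X^0 = 1]; the entries of [M' *m v] are the
     [r i], which lie in [K]. *)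
  have -> : (\det M)%:P = (\adj M' *m (M' *m v)) (Ordinal e_gt0) 0.
    by rewrite mulmxA mul_adj_mx mul_scalar_mx !mxE /= mulr1 det_map_mx.
  by rewrite mxE; apply: ideal_sum => // i _; rewrite M'v; apply: idealMl.
move/K_const; rewrite -det_map_mx evM det1 => /eqP.
by rewrite oner_eq0.
Qed.

(** The image of [K] in [{poly k}] is an ideal, nonzero because of [f] and proper by
    [extend_point_proper]. Its generator [h] is therefore not constant and has a root, common to all
    elements of the image. *)
Lemma extend_point :
  exists t, forall g, K g -> (map_poly ev g).[t] = 0.
Proof.
pose L := [set q | exists2 g, K g & map_poly ev g = q].
have idL : is_ideal L.
  split; first by exists 0; [exact: ideal0 | rewrite rmorph0].
  move=> a _ _ [x Kx <-] [y Ky <-]; have [b <-] := map_poly_surj a.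
  exists (b * x + y); last by rewrite rmorphD rmorphM.
  by apply: idealD => //; apply: idealMl.
pose P d := `[< exists2 q, L q & q != 0 /\ size q = d >].
have exP : exists d, P d.
  exists (size (map_poly ev f)); apply/asboolP; exists (map_poly ev f).
    by exists f.
  by split=> //; rewrite monic_neq0 // monic_map.
have [d /asboolP[h Lh [h0 szh]] min_d] := ex_minnP exP.
have h_dvd q : L q -> h %| q.
  move=> Lq; rewrite /dvdp; apply: contraT => qh0.
  have : (d <= size (q %% h)%R)%N.
    apply: min_d; apply/asboolP; exists (q %% h) => //.
    have /(canLR (addKr _)) <- := divp_eq q h.
    by apply: idealD => //; apply/(idealN idL)/(idealMl idL).
  by rewrite -szh leqNgt ltn_modp h0.
have : size h != 1.
  apply/eqP => /eqP/size_poly1P[c c0 hE].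
  have [g Kg] : L 1.
    have -> : 1 = c^-1%:P * h by rewrite hE -polyCM mulVf.
    exact: idealMl.
  by apply/eqP; exact: extend_point_proper.
move=> /closed_rootP[t ht]; exists t => g Kg.
have /dvdpP[q ->] : h %| map_poly ev g by apply: h_dvd; exists g.
by rewrite hornerM (rootP ht) mulr0.
Qed.

End ExtendPoint.

Lemma mpoly_rmorph_ext (n : nat) (R S : comNzRingType)
    (f g : {rmorphism {mpoly R[n]} -> S}) :
  (forall c, f c%:MP = g c%:MP) -> (forall i, f 'X_i = g 'X_i) -> f =1 g.
Proof.
move=> fgC fgX p; rewrite [p]mpolyE !rmorph_sum; apply: eq_bigr => m _.
rewrite -mul_mpolyC !rmorphM /= fgC; congr (_ * _).
rewrite mpolyXE_id !rmorph_prod; apply: eq_bigr => i _ /=.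
by rewrite !rmorphXn /= fgX.
Qed.

Lemma horner_muni (n : nat) (R S : comNzRingType) (c : {rmorphism R -> S})
    (v : 'I_n.+1 -> S) (p : {mpoly R[n.+1]}) :
  (map_poly (mmap c (fun i => v (widen_ord (leqnSn n) i))) (muni p)).[v ord_max]
  = mmap c v p.
Proof.
rewrite muniE rmorph_sum horner_sum; apply: eq_bigr => m _.
rewrite -mul_polyC rmorphM /= map_polyXn hornerM hornerXn map_polyC hornerC /=.
rewrite mmapZ mmapX -mulrA; congr (_ * _).
rewrite /mmap1 big_ord_recr /=; congr (_ * _); apply: eq_bigr => i _.
by rewrite mnmE.
Qed.

(** Induction on the number of variables: where the leading coefficient in the last variable does
    not vanish, a nonzero univariate polynomial remains, which has a nonroot. *)
Lemma mpoly_nonroot (k : closedFieldType) (n : nat) (p : {mpoly k[n]}) :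
  p != 0 -> exists v, p.@[v] != 0.
Proof.
elim: n p => [|n IHn] p p0.
  exists (fun=> 0); have /msize1_polyC pE : (msize p <= 1)%N.
    by rewrite msizeE; apply/bigmax_leqP_seq => m _ _; rewrite mdegE big_ord0.
  by move: p0; rewrite pE mevalC mpolyC_eq0.
have q0 : muni p != 0.
  apply/eqP => q0; move: p0; rewrite -[p]comp_mpoly_id.
  rewrite /comp_mpoly -(horner_muni (@mpolyC n.+1 k)).
  by rewrite q0 rmorph0 horner0 eqxx.
have [v qv0] := IHn (lead_coef (muni p)) (etrans (congr1 negb (lead_coef_eq0 _)) q0).
have /closed_nonrootP[t] : map_poly (meval v) (muni p) != 0.
  apply/eqP => /polyP/(_ (size (muni p)).-1); rewrite coef_map coef0 /=.
  by apply/eqP.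
rewrite rootE => vt0.
pose w i := if unlift ord_max i is Some j then v j else t.
have wE i : w (widen_ord (leqnSn n) i) = v i.
  rewrite /w; case: unliftP => [j|] /(congr1 val) /=.
    by rewrite /bump leqNgt ltn_ord add0n => /val_inj->.
  by move=> /eqP; rewrite ltn_eqF.
exists w; move: vt0; rewrite /meval -(horner_muni idfun w) {2}/w unlift_none.
by under [fun i => w _]funext do rewrite wE.
Qed.

(** * Leading coefficients along a line *)

Section TopForm.
Variables (n : nat) (k : comNzRingType).

Definition top_form (p : {mpoly k[n]}) : {mpoly k[n]} :=
  \sum_(m <- msupp p | mdeg m == (msize p).-1) p@_m *: 'X_[m].

Lemma top_form_neq0 p : p != 0 -> top_form p != 0.
Proof.
move=> p0; apply/eqP => /(congr1 (mcoeff (mlead p))).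
rewrite mcoeff0 linear_sum /= big_mkcond (bigD1_seq (mlead p)) ?mlead_supp //=.
rewrite -mlead_deg //= eqxx mcoeffZ mcoeffX eqxx mulr1 big1 ?addr0.
  by move/eqP; rewrite mleadc_eq0 (negPf p0).
move=> m mp; case: ifP => // _.
by rewrite mcoeffZ mcoeffX (negPf mp) mulr0.
Qed.

(** Here [d] only bounds the degree and [x] may be 0, which makes the notion multiplicative over any
    ring. *)
Definition top_coef (R : nzRingType) (q : {poly R}) (d : nat) (x : R) : Prop :=
  (size q <= d.+1)%N /\ q`_d = x.

Lemma top_coefM (R : nzRingType) (p q : {poly R}) d e x y :
  top_coef p d x -> top_coef q e y -> top_coef (p * q) (d + e) (x * y).
Proof.
move=> [szp <-] [szq <-]; split.
  apply: leq_trans (size_polyMleq _ _) _; rewrite -subn1 leq_subLR.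
  by rewrite add1n -addSn -addnS leq_add.
rewrite coefM (bigD1 (inord d)) //= inordK ?ltnS ?leq_addr // addKn.
rewrite big1 ?addr0 // => i /eqP id.
have [ltid|ltdi|eqid] := ltngtP i d.
- rewrite [q`_(d + e - i)]nth_default ?mulr0 //.
  by apply: leq_trans szq _; rewrite ltn_subRL ltn_add2r.
- by rewrite nth_default ?mul0r //; apply: leq_trans szp _.
- by case: id; apply: val_inj; rewrite /= inordK ?ltnS ?leq_addr.
Qed.

Lemma top_coef_prod (R : nzRingType) (I : Type) (r : seq I) (F : I -> {poly R})
    (d : I -> nat) (x : I -> R) :
  (forall i, top_coef (F i) (d i) (x i)) ->
  top_coef (\prod_(i <- r) F i) (\sum_(i <- r) d i) (\prod_(i <- r) x i).
Proof.
move=> FE; elim: r => [|i r IHr].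
  by rewrite !big_nil; split; rewrite ?coef1 // size_poly1.
by rewrite !big_cons; apply: top_coefM.
Qed.

Lemma top_coefX (R : nzRingType) (p : {poly R}) d x e :
  top_coef p d x -> top_coef (p ^+ e) (d * e) (x ^+ e).
Proof.
move=> px; elim: e => [|e IHe].
  by rewrite muln0 !expr0; split; rewrite ?coef1 // size_poly1.
by rewrite mulnS !exprS; apply: top_coefM.
Qed.

(** On the line through [u] with direction [l], a monomial of degree [d] contributes at most [X^d],
    so only the monomials of top degree reach the last coefficient. *)
Lemma mmap_top_form (R : comNzRingType) (c : {rmorphism k -> R})
    (u : 'I_n -> R) (l : 'I_n -> k) (p : {mpoly k[n]}) : p != 0 ->
  top_coef (mmap (polyC \o c) (fun i => (u i)%:P + c (l i) *: 'X) p)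
    (msize p).-1 (c (top_form p).@[l]).
Proof.
move=> p0; rewrite /mmap.
have sp : (msize p).-1.+1 = msize p by rewrite prednK // lt0n msize_poly_eq0.
pose h i := (u i)%:P + c (l i) *: 'X.
have hm m : top_coef (mmap1 h m) (mdeg m) (c (\prod_i l i ^+ m i)).
  rewrite rmorph_prod mdegE; apply: top_coef_prod => i; rewrite rmorphXn /=.
  have := @top_coefX _ (h i) 1 (c (l i)) (m i); rewrite mul1n; apply.
  split; last first.
    by rewrite coefD coefC coefZ coefX mulr1 add0r.
  rewrite (leq_trans (size_polyD _ _)) // geq_max size_polyC.
  rewrite (leq_trans (leq_b1 _)) //=.
  by rewrite (leq_trans (size_scale_leq _ _)) // size_polyX.
split.
  rewrite sp big_seq; apply: (big_ind (fun q : {poly R} => size q <= msize p)%N).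
  - by rewrite size_poly0.
  - by move=> q r qp rp; rewrite (leq_trans (size_polyD _ _)) // geq_max qp.
  - move=> m mp; rewrite mul_polyC (leq_trans (size_scale_leq _ _)) //.
    by apply: leq_trans (hm m).1 _; apply: msize_mdeg_lt.
rewrite coef_sum /top_form linear_sum /= rmorph_sum /= [RHS]big_mkcond /=.
apply: eq_big_seq => m mp /=; rewrite coefCM.
case: eqP => [<-|/eqP dm]; first by rewrite mevalZ mevalX rmorphM -(hm m).2.
rewrite [X in _ * X]nth_default ?mulr0 //; apply: leq_trans (hm m).1 _.
by rewrite ltn_neqAle dm -ltnS sp msize_mdeg_lt.
Qed.

End TopForm.

(* Write [b = u(b') + l t] with [b'] of one variable less. A relation [p] among
   the [b i] becomes monic in [t] up to the scalar [top_form p (l)], so a point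
   for [b'] extends to one for [b]. *)
Lemma weak_nullstellensatz (k : closedFieldType) (n : nat) (B : comNzRingType)
    (c : {rmorphism k -> B}) (b : 'I_n -> B) (J : set B) :
  is_ideal J -> ~ J 1 ->
  exists x : 'I_n -> k, forall p, J (mmap c b p) -> p.@[x] = 0.
Proof.
move=> idJ J1; elim: n b => [|n IHn] b.
  exists (fun=> 0) => p.
  have /msize1_polyC-> : (msize p <= 1)%N.
    by rewrite msizeE; apply/bigmax_leqP_seq => m _ _; rewrite mdegE big_ord0.
  rewrite mmapC mevalC => Jp; apply: contrapT => /eqP p0; apply: J1.
  by rewrite -(rmorph1 c) -(mulVf p0) rmorphM; apply: idealMl.
have [noalg|] := pselect (forall p, J (mmap c b p) -> p = 0).
  by exists (fun=> 0) => p /noalg->; rewrite meval0.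
move=> /existsNP[p /not_implyP[Jp /eqP p0]].
(* The factor ['X_ord0] also forces [l ord0 != 0], needed to solve for [t]. *)
have [l] : exists l, (top_form p * 'X_ord0).@[l] != 0.
  apply: mpoly_nonroot; rewrite mulf_neq0 ?top_form_neq0 //.
  by rewrite -msize_poly_eq0 msizeX.
rewrite mevalM mevalXU mulf_eq0 negb_or => /andP[pl0 l0].
(* Change of coordinates: the variable [ord0] becomes [l ord0 * t], and each other one becomes a new
   variable plus its entry of [l] times [t]. The elements [b'] and [t] below are the new coordinates
   of [b]. *)
pose u (i : 'I_n.+1) : {mpoly k[n]} := if unlift ord0 i is Some j then 'X_j else 0.
pose S := mmap (polyC \o @mpolyC n k) (fun i => (u i)%:P + (l i)%:MP *: 'X).
pose b' i := b (lift ord0 i) - c (l (lift ord0 i) / l ord0) * b ord0.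
pose t := c (l ord0)^-1 * b ord0.
have [x' x'0] := IHn b'.
pose K := [set g : {poly {mpoly k[n]}} | J (map_poly (mmap c b') g).[t]].
have KS q : mmap c b q = (map_poly (mmap c b') (S q)).[t].
  pose g := horner_eval t \o map_poly (mmap c b') \o S.
  apply: (@mpoly_rmorph_ext _ _ _ (mmap c b) g) => [a|i].
    by rewrite /g /= /horner_eval /S !mmapC /= map_polyC hornerC /= mmapC.
  rewrite /g /= /horner_eval /S !mmapX !mmap1U rmorphD /= map_polyZ map_polyC.
  rewrite map_polyX hornerD hornerC hornerZ hornerX /= mmapC /u /t.
  case: unliftP => [j ->|->]; rewrite ?mmapX ?mmap1U ?mmap0 /b' ?rmorphM ?fmorphV.
    by rewrite mulrA subrK.
  by rewrite mulrA add0r -rmorphM divff // rmorph1 mul1r.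
have idK : is_ideal K.
  split; first by rewrite /K /= rmorph0 horner0; exact: ideal0.
  move=> a y z Ky Kz; rewrite /K /= rmorphD rmorphM /= hornerD hornerM.
  by apply: idealD => //; apply: idealMl.
have [szS Stop] := mmap_top_form (@mpolyC n k) u l p0.
pose f := ((top_form p).@[l])^-1%:MP *: S p.
have fS : f = ((top_form p).@[l])^-1%:MP *: S p by [].
have f_top : f`_(msize p).-1 = 1.
  by rewrite fS coefZ Stop -mpolyCM mulVf.
have szf : size f = (msize p).-1.+1.
  apply/eqP; rewrite eqn_leq (leq_trans (size_scale_leq _ _)) //=.
  by rewrite ltnNge; apply/negP => /leq_sizeP/(_ _ (leqnn _))/eqP; rewrite f_top oner_eq0.
have f_monic : f \is monic by rewrite monicE lead_coefE szf f_top.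
have Kf : K f.
  by rewrite fS -mul_polyC; apply: idealMl => //; rewrite /K /= -KS.
have surj a : exists r : {mpoly k[n]}, r.@[x'] = a by exists a%:MP; rewrite mevalC.
have K_const r : K r%:P -> r.@[x'] = 0.
  by rewrite /K /= map_polyC hornerC; apply: x'0.
have [a aK] := extend_point surj idK f_monic Kf K_const.
exists (fun i => (u i).@[x'] + l i * a) => q Jq.
have <- := aK (S q); last by rewrite /K /= -KS.
pose g := horner_eval a \o map_poly (meval x') \o S.
apply: (@mpoly_rmorph_ext _ _ _ (meval _) g) => [e|i].
  by rewrite /g /= /horner_eval /S mmapC /= map_polyC hornerC /= !mevalC.
rewrite /g /= /horner_eval /S mevalXU mmapX mmap1U rmorphD /= map_polyZ map_polyC.
by rewrite map_polyX hornerD hornerC hornerZ hornerX /= mevalC.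
Qed.

(** * Noetherian rings and Krull's intersection theorem *)

Section Noetherian.

Definition span (R : pzRingType) (u : nat -> R) (N : nat) : set R :=
  [set x | exists c : nat -> R, x = \sum_(i < N) c i * u i].

(* Every sequence of ideals [(u 0, ..., u N)] stabilizes, in the weak form that
   one of its steps is not strict. *)
Definition noetherian (R : pzRingType) : Prop :=
  forall u : nat -> R, exists N, span u N (u N).

Lemma span_ideal (R : pzRingType) (u : nat -> R) N : is_ideal (span u N).
Proof.
split; first by exists (fun=> 0); rewrite big1 // => i _; rewrite mul0r.
move=> a _ _ [c ->] [d ->]; exists (fun i => a * c i + d i).
rewrite mulr_sumr -big_split; apply: eq_bigr => i _ /=.
by rewrite mulrDl mulrA.
Qed.

Lemma span_mem (R : pzRingType) (u : nat -> R) N i : (i < N)%N -> span u N (u i).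
Proof.
move=> lt_iN; exists (fun j => (j == i)%:R).
rewrite (bigD1 (Ordinal lt_iN)) //= eqxx mul1r big1 ?addr0 // => j.
by rewrite -val_eqE /= => /negPf->; rewrite mul0r.
Qed.

Lemma span_sub (R : pzRingType) (u : nat -> R) N (I : set R) :
  is_ideal I -> (forall i, (i < N)%N -> I (u i)) -> span u N `<=` I.
Proof.
by move=> idI Iu _ [c ->]; apply: ideal_sum => // i _; apply: idealMl => //; exact: Iu.
Qed.

Lemma span_le (R : pzRingType) (u : nat -> R) M N :
  (M <= N)%N -> span u M `<=` span u N.
Proof.
move=> leMN; apply: span_sub; first exact: span_ideal.
by move=> i ltiM; apply/span_mem/(leq_trans ltiM).
Qed.

Lemma noetherian_surj (R S : pzRingType) (f : {rmorphism R -> S}) :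
  (forall y, exists x, f x = y) -> noetherian R -> noetherian S.
Proof.
move=> /choice[g gK] noR u; have [N [c cE]] := noR (g \o u).
exists N, (f \o c); rewrite -[LHS]gK; move/(congr1 f): cE => /= ->; rewrite rmorph_sum.
by apply: eq_bigr => i _; rewrite rmorphM /= gK.
Qed.

Lemma noetherian_field (k : fieldType) : noetherian k.
Proof.
move=> u; have [u00|u00] := eqVneq (u 0%N) 0.
  by exists 0%N, (fun=> 0); rewrite big_ord0.
by exists 1%N, (fun=> u 1%N / u 0%N); rewrite big_ord1 divfK.
Qed.

(* Hilbert's argument: otherwise pick [v N] of minimal size outside the ideal
   generated by the previous ones; a relation between the leading coefficients
   then lowers the size of some [v N]. *)
Lemma noetherian_poly (R : comNzRingType) : noetherian R -> noetherian {poly R}.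
Proof.
move=> noR u; apply: contrapT => /forallNP uN.
pose I := [set x | exists N, span u N x].
have idI : is_ideal I.
  split; first by exists 0%N; apply: ideal0; exact: span_ideal.
  move=> a x y [N xN] [M yM]; exists (maxn N M).
  apply: idealD; [exact: span_ideal| |].
    by apply: idealMl; [exact: span_ideal | apply: span_le xN; exact: leq_maxl].
  by apply: span_le yM; exact: leq_maxr.
pose gen (s : seq {poly R}) := span (nth 0 s) (size s).
(* The assumption on [s] stands inside the existential so that [choice] gives a total function. A
   minimum exists since a finite part of [I] lies in some [span u N], which misses [u N]. *)
have pickP (s : seq {poly R}) : exists p, (forall x, x \in s -> I x) ->
    [/\ I p, ~ gen s p & forall q, I q -> ~ gen s q -> (size p <= size q)%N].
  have [sI|] := pselect (forall x, x \in s -> I x); last by exists 0.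
  have [N sN] : exists N, forall x, x \in s -> span u N x.
    elim: s sI => [|x s IHs] sI; first by exists 0%N.
    have [y ys|N sN] := IHs; first by apply: sI; rewrite inE ys orbT.
    have [M xM] := sI x (mem_head _ _); exists (maxn N M) => y.
    rewrite inE => /orP[/eqP->|/sN yN].
      by apply: span_le xM; exact: leq_maxr.
    by apply: span_le yN; exact: leq_maxl.
  pose P d := `[< exists2 q, I q /\ ~ gen s q & size q = d >].
  have exP : exists d, P d.
    exists (size (u N)); apply/asboolP; exists (u N) => //; split.
      by exists N.+1; apply: span_mem.
    move=> sNu; apply: (uN N); apply: (span_sub (span_ideal u N) _ sNu) => i lt_is.
    by apply: sN; exact: mem_nth.
  have [d /asboolP[p [Ip sp] szp] min_d] := ex_minnP exP.
  exists p => _; split=> // q Iq sq; rewrite szp; apply: min_d.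
  by apply/asboolP; exists q.
have [pick {}pickP] := choice pickP.
pose fix L N := if N is N'.+1 then rcons (L N') (pick (L N')) else [::].
pose v N := pick (L N).
have LE N : L N = mkseq v N by elim: N => //= N IHN; rewrite mkseqS -IHN.
have genE N x : gen (L N) x <-> span v N x.
  rewrite LE /gen size_mkseq; split=> -[c ->]; exists c;
    by apply: eq_bigr => i _; rewrite nth_mkseq.
have LI N : forall x, x \in L N -> I x.
  elim: N => // N IHN x /=; rewrite mem_rcons inE => /orP[/eqP->|/IHN//].
  by have [] := pickP _ IHN.
have vP N : [/\ I (v N), ~ span v N (v N) &
    forall q, I q -> ~ span v N q -> (size (v N) <= size q)%N].
  have [Iv gv minv] := pickP _ (LI N); split=> // [/genE//|q Iq vq].
  by apply: minv => // /genE.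
have v0 N : (0 < size (v N))%N.
  rewrite lt0n size_poly_eq0; apply/eqP => v0; have [_ + _] := vP N.
  by rewrite v0; apply; apply: ideal0; exact: span_ideal.
have [N [c cE]] := noR (lead_coef \o v).
have [IvN vN minN] := vP N.
(* [v N] was already a candidate when [v i] was picked, so sizes do not decrease and the subtraction
   in the exponents of [w] is exact. *)
have le_size i : (i < N)%N -> (size (v i) <= size (v N))%N.
  move=> lt_iN; have [_ _] := vP i; apply=> // viN; apply: vN.
  exact: (span_le (ltnW lt_iN) viN).
pose w := v N - \sum_(i < N) c i *: ('X^(size (v N) - size (v i)) * v i).
have Nvw : span v N (v N - w).
  rewrite subKr; apply: ideal_sum => [|i _]; first exact: span_ideal.
  rewrite -mul_polyC; do 2![apply: idealMl; first exact: span_ideal].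
  exact: span_mem.
have : (size (v N) <= size w)%N.
  apply: minN.
    rewrite /w; apply: idealB => //; apply: ideal_sum => // i _.
    by rewrite -mul_polyC; do 2!apply: idealMl => //; have [] := vP i.
  move=> Nw; apply: vN; rewrite -[v N](subrK w).
  by apply: idealD => //; exact: span_ideal.
apply/negP; rewrite -ltnNge -(prednK (v0 N)) ltnS; apply/leq_sizeP => j le_dj.
rewrite coefB coef_sum; move: le_dj; rewrite leq_eqVlt => /orP[/eqP<-|lt_dj].
  rewrite -lead_coefE [lead_coef _]cE; apply/eqP; rewrite subr_eq0; apply/eqP.
  apply: eq_bigr => i _; rewrite coefZ coefXnM.
  have := le_size i (ltn_ord i); have := v0 i; have := v0 N => vN0 vi0 le_i.
  rewrite /= lead_coefE; move: vN0 vi0 le_i.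
  move: (size (v N)) (size (v i)) => a b a0 b0 le_ba.
  have -> : (a.-1 < a - b)%N = false by lia.
  by congr (_ * _`_ _); lia.
rewrite nth_default; last by move: (v0 N) lt_dj; case: (size (v N)).
rewrite big1 ?subr0 // => i _; rewrite coefZ coefXnM.
case: ifP => _; rewrite ?mulr0 // nth_default ?mulr0 //.
move: (le_size i (ltn_ord i)) (v0 i) lt_dj.
by move: (size (v N)) (size (v i)) => a b le_ba b0 lt_aj; lia.
Qed.

Lemma noetherian_mpoly (n : nat) (R : comNzRingType) :
  noetherian R -> noetherian {mpoly R[n]}.
Proof.
move=> noR; elim: n => [|n IHn].
  apply: (noetherian_surj (f := @mpolyC 0 R)) => // p; exists p@_0.
  apply/esym/msize1_polyC; rewrite msizeE; apply/bigmax_leqP_seq => m _ _.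
  by rewrite mdegE big_ord0.
pose f := mmap (@mpolyC n.+1 R) (fun i => 'X_(widen_ord (leqnSn n) i)).
apply: (noetherian_surj (f := horner_eval 'X_ord_max \o map_poly f)) => [p|].
  exists (muni p); rewrite /= /horner_eval /f (horner_muni _ (fun i => 'X_i)).
  apply: (@mpoly_rmorph_ext _ _ _ (mmap _ _) idfun) => [c|i] /=.
    exact: mmapC.
  by rewrite mmapX mmap1U.
exact: noetherian_poly.
Qed.

End Noetherian.

(** * Powers of an ideal and the Rees ring *)

Section PowersOfIdeals.
Variables (A : comNzRingType) (n : nat) (s : 'I_n -> A).

Fixpoint ideal_power (N : nat) : set A :=
  if N is N'.+1 then
    [set f | exists2 c : 'I_n -> A,
       (forall i, ideal_power N' (c i)) & f = \sum_i s i * c i]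
  else setT.

Lemma ideal_power_ideal N : is_ideal (ideal_power N).
Proof.
elim: N => [|N IHN] //; split.
  exists (fun=> 0) => [i|]; first exact: ideal0.
  by rewrite big1 // => i _; rewrite mulr0.
move=> a _ _ [c cN ->] [d dN ->]; exists (fun i => a * c i + d i) => [i|].
  exact: (idealD IHN (idealMl IHN a (cN i)) (dN i)).
by rewrite mulr_sumr -big_split; apply: eq_bigr => i _ /=; ring.
Qed.

Lemma ideal_powerM N M f g :
  ideal_power N f -> ideal_power M g -> ideal_power (N + M) (f * g).
Proof.
elim: N f => [|N IHN] f /=; first by move=> _; apply: idealMl; exact: ideal_power_ideal.
move=> [c cN ->] gM; exists (fun i => c i * g) => [i|]; first exact: IHN.
by rewrite mulr_suml; apply: eq_bigr => i _; rewrite mulrA.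
Qed.

Lemma ideal_power_gen i : ideal_power 1 (s i).
Proof.
exists (fun j => (j == i)%:R) => //.
by rewrite (bigD1 i) //= eqxx mulr1 big1 ?addr0 // => j /negPf->; rewrite mulr0.
Qed.

Lemma ideal_powerS N f : ideal_power N.+1 f -> ideal_power N f.
Proof.
elim: N f => [//|N IHN] f [c cN ->]; exists c => // i; exact: IHN (cN i).
Qed.

(** The image is the Rees ring of the ideal generated by [s]: its part of degree [N] is the [N]-th
    power of the ideal, times [X^N]. *)
Definition rees : {mpoly A[n]} -> {poly A} := mmap polyC (fun i => s i *: 'X).

Lemma ideal_power_rees N f :
  ideal_power N f -> exists P, rees P = f *: 'X^N.
Proof.
elim: N f => [|N IHN] f.
  by move=> _; exists f%:MP; rewrite /rees mmapC expr0 alg_polyC.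
move=> [c cN ->].
have /choice[P PE] : forall i, exists P, rees P = c i *: 'X^N.
  by move=> i; apply: IHN (cN i).
exists (\sum_i 'X_i * P i).
rewrite /rees rmorph_sum scaler_suml; apply: eq_bigr => i _ /=.
rewrite rmorphM /= mmapX mmap1U [mmap _ _ _]PE.
by rewrite exprS -scalerAl -scalerAr scalerA.
Qed.

Variable m : set A.
Hypotheses (idm : is_ideal m) (ms : forall i, m (s i)).

(** The polynomials whose coefficients of positive degree lie in [m] form a subring containing the
    constants and all [s i *: 'X]. *)
Lemma rees_coef_gt0 P j : m (rees P)`_j.+1.
Proof.
pose S := [set q : {poly A} | forall j, m q`_j.+1].
have SM p q : S p -> S q -> S (p * q).
  move=> Sp Sq i; rewrite coefM; apply: ideal_sum => // -[[|a] lt_a] _ /=.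
    by rewrite subn0; apply: idealMl.
  by rewrite mulrC; apply: idealMl.
have SC a : S a%:P by move=> i; rewrite coefC; exact: ideal0.
suff : S (rees P) by apply.
have S1 : S 1 by exact: (SC 1).
rewrite /rees /mmap; apply: (big_ind S) => [i|p q Sp Sq i|x _].
- by rewrite coef0; exact: ideal0.
- by rewrite coefD; apply: (idealD idm (Sp i) (Sq i)).
apply: (SM); first exact: SC.
rewrite /mmap1; apply: (big_ind S) => [//|p q|l _]; first exact: SM.
elim: (x l) => [|e IHe]; first by rewrite expr0.
rewrite exprS; apply: SM => // i; rewrite coefZ coefX mulrC.
exact: idealMl.
Qed.

(* If [f X^N] is the image of [P N] in the Rees ring for all [N], then a relation
   [P N = \sum_(i < N) Q i * P i] gives [f = u f] by comparing the coefficients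
   of [X^N], where [u] collects coefficients of positive degree. *)
Lemma krull_intersection f : noetherian A ->
  (forall N, ideal_power N f) -> exists2 u, m u & f = u * f.
Proof.
move=> noA fN; have /choice[P PE] : forall N, exists P, rees P = f *: 'X^N.
  by move=> N; apply: ideal_power_rees (fN N).
have [N [c cE]] := noetherian_mpoly (n := n) noA P.
exists (\sum_(i < N) (rees (c i))`_(N - i)).
  by apply: ideal_sum => // i _; rewrite -subnSK //; exact: rees_coef_gt0.
move: cE => /(congr1 (fun P => (rees P)`_N)).
rewrite PE coefZ coefXn eqxx mulr1 => {1}->.
rewrite /rees rmorph_sum coef_sum mulr_suml; apply: eq_bigr => i _ /=.
rewrite rmorphM /= [mmap _ _ (P i)]PE -scalerAr coefZ coefMXn ltnNge ltnW //=.
by rewrite mulrC.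
Qed.

End PowersOfIdeals.

(** * Euler fields *)

Lemma mpoly_ring_ind (n : nat) (R : comNzRingType) (P : {mpoly R[n]} -> Prop) :
  (forall c, P c%:MP) -> (forall i, P 'X_i) ->
  (forall p q, P p -> P q -> P (p + q)) ->
  (forall p q, P p -> P q -> P (p * q)) -> forall p, P p.
Proof.
move=> PC PX PD PM p; rewrite [p]mpolyE.
apply: (big_ind P) => [|//|m _]; first by rewrite -mpolyC0.
rewrite -mul_mpolyC; apply: (PM) => //; rewrite mpolyXE_id.
apply: (big_ind P) => [|//|i _]; first exact: (PC 1).
by elim: (m i) => [|e IHe]; [exact: (PC 1) | rewrite exprS; apply: PM].
Qed.

(** First-order Taylor expansion at [x]. It is trivial on constants and variables and stable under
    sums and products, so no higher derivatives are needed. *)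
Lemma taylor_order2 (n : nat) (R A : comNzRingType)
    (f : {rmorphism {mpoly R[n]} -> A}) (x : 'I_n -> R) (p : {mpoly R[n]}) :
  let s i := f ('X_i - (x i)%:MP) in
  ideal_power s 2
    (f p - f (p.@[x])%:MP - \sum_i f (p^`M(i).@[x])%:MP * s i).
Proof.
move=> s; have id2 := ideal_power_ideal s 2.
have s1 := ideal_power_gen s; have id1 := ideal_power_ideal s 1.
elim/mpoly_ring_ind: p => [c|j|p q IHp IHq|p q IHp IHq].
- rewrite mevalC subrr big1 ?subr0; first exact: (ideal0 id2).
  by move=> i _; rewrite mderivC meval0 mpolyC0 rmorph0 mul0r.
- rewrite mevalXU (bigD1 j) //= big1 => [|i ij].
    rewrite addr0 mderivX mnm1E eqxx scale1r /s rmorphB.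
    have -> : (U_(j) - U_(j) = 0)%MM by apply/mnmP => l; rewrite mnmBE subnn mnm0E.
    by rewrite mpolyX0 meval1 mpolyC1 rmorph1 mul1r subrr; exact: (ideal0 id2).
  rewrite mderivX mnm1E eq_sym (negPf ij) scale0r meval0 mpolyC0 rmorph0.
  by rewrite mul0r.
- have := idealD id2 IHp IHq; congr (ideal_power _ _ _).
  rewrite mevalD mpolyCD !rmorphD /=.
  under [in RHS]eq_bigr do rewrite mderivD mevalD mpolyCD rmorphD mulrDl.
  by rewrite big_split /=; ring.
pose dp := \sum_i f (p^`M(i).@[x])%:MP * s i.
pose dq := \sum_i f (q^`M(i).@[x])%:MP * s i.
have d1 (a : 'I_n -> A) : ideal_power s 1 (\sum_i a i * s i).
  by apply: ideal_sum => // i _; apply: (idealMl id1).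
have -> : \sum_i f ((p * q)^`M(i).@[x])%:MP * s i =
    f (q.@[x])%:MP * dp + f (p.@[x])%:MP * dq.
  rewrite !mulr_sumr -big_split; apply: eq_bigr => i _ /=.
  by rewrite mderivM mevalD !mevalM mpolyCD !mpolyCM rmorphD !rmorphM /=; ring.
rewrite -/dp in IHp; rewrite -/dq in IHq.
set ep := f p - _ - _ in IHp; set eq := f q - _ - _ in IHq.
(* This is the remainder of the product: [dp * dq] has two factors in the ideal, and the other terms
   are multiples of the remainders [ep] and [eq]. *)
have : ideal_power s 2 (dp * dq + f q * ep + (f (p.@[x])%:MP + dp) * eq).
  apply: (idealD id2); last exact: (idealMl id2).
  apply: (idealD id2); last exact: (idealMl id2).
  exact: (ideal_powerM (N := 1) (M := 1) (d1 _) (d1 _)).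
congr (ideal_power _ _ _); rewrite mevalM mpolyCM !rmorphM /= /ep /eq; ring.
Qed.

Section EulerField.
Variables (k : fieldType) (A : comAlgType k) (n : nat) (s : 'I_n -> A).
Variables (delta : 'I_n -> derivation A).

(* [theta] acts on [m^N / m^(N+1)] as multiplication by [N], where [m = (s)]; for
   a stable ideal [I] contained in [m^N], however, [theta] maps [I] into
   [m^(N+1)]. *)
Let theta f := \sum_i s i * delta i f.

Hypothesis theta_s : forall i, ideal_power s 2 (theta (s i) - s i).

Lemma thetaD f g : theta (f + g) = theta f + theta g.
Proof.
by rewrite /theta -big_split; apply: eq_bigr => i _; rewrite derD mulrDr.
Qed.

Lemma thetaM f g : theta (f * g) = theta f * g + f * theta g.
Proof.
rewrite /theta mulr_suml mulr_sumr -big_split; apply: eq_bigr => i _ /=.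
by rewrite der_leibniz; ring.
Qed.

Lemma theta_sum (F : 'I_n -> A) : theta (\sum_i F i) = \sum_i theta (F i).
Proof.
apply: big_morph => [f g|]; first exact: thetaD.
by apply: (addrI (theta 0)); rewrite -thetaD !addr0.
Qed.

(** Leibniz rule on [s i * c i]: the first factor has eigenvalue 1 by [theta_s], the second
    eigenvalue [N] by induction, each modulo one more power. *)
Lemma euler_eigen N f :
  ideal_power s N f -> ideal_power s N.+1 (theta f - f *+ N).
Proof.
elim: N f => [|N IHN] f.
  by move=> _; rewrite subr0; exists (fun i => delta i f).
have id2 := ideal_power_ideal s N.+2.
move=> [c cN ->]; rewrite theta_sum -sumrMnl -sumrB; apply: ideal_sum => // i _.
have -> : theta (s i * c i) - s i * c i *+ N.+1 =
    (theta (s i) - s i) * c i + s i * (theta (c i) - c i *+ N).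
  by rewrite thetaM mulrSr mulrBr mulrBl mulrnAr; ring.
apply: (idealD id2).
  exact: (ideal_powerM (N := 2) (theta_s i) (cN i)).
exact: (ideal_powerM (N := 1) (ideal_power_gen s i) (IHN _ (cN i))).
Qed.

Lemma stable_sub_ideal_power (I : set A) : [pchar k] =i pred0 ->
  derivation_stable I -> I `<=` ideal_power s 1 ->
  forall N, I `<=` ideal_power s N.
Proof.
move=> char0 stI I1; elim=> [//|[//|N] IHN] f If.
have idN := ideal_power_ideal s N.+2.
(* Both [theta f] and [theta f - f *+ N.+1] lie in this power, the former because each [delta i f]
   stays in [I]. Characteristic 0 then allows division by [N.+1]. *)
have : ideal_power s N.+2 (f *+ N.+1).
  rewrite -[f *+ _](subKr (theta f)).
  apply: (idealB idN); last exact: euler_eigen (IHN _ If).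
  by exists (fun i => delta i f) => // i; apply: IHN; apply: stI.
move=> /(idealMl idN (N.+1%:R^-1)%:A).
rewrite -scalerAl mul1r -scaler_nat scalerA mulVf ?scale1r //.
by move/pcharf0P: char0 => ->.
Qed.

End EulerField.

(** * Tangent vector fields on a smooth variety *)

Section LinearAlgebra.
Variables (k : fieldType) (n : nat).

Lemma maximal_row_free (G : set 'rV[k]_n) :
  exists r (F : 'M[k]_(r, n)), [/\ forall i, G (row i F), row_free F &
    forall g, G g -> (g <= F)%MS].
Proof.
pose P r := `[< exists2 F : 'M[k]_(r, n), forall i, G (row i F) & row_free F >].
have P0 : exists r, P r.
  exists 0%N; apply/asboolP; exists 0 => [[]//|].
  by rewrite /row_free mxrank0.
have Pn r : P r -> (r <= n)%N.
  by move=> /asboolP[F _ /eqP<-]; exact: rank_leq_col.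
case: (ex_maxnP P0 Pn) => r /asboolP[F FG Ffree] maxr.
exists r, F; split=> // g Gg; apply: contraT => gF.
suff /maxr : P (1 + r)%N by rewrite ltnn.
apply/asboolP; exists (col_mx g F) => [i|].
  have [j ->|j ->] := split_ordP i; last by rewrite rowKd.
  by rewrite rowKu (ord1 j) row_id.
rewrite /row_free eqn_leq rank_leq_row /=.
have := @rank_ltmx _ _ _ _ F (col_mx g F); rewrite (eqP Ffree); apply.
by rewrite /ltmx -!addsmxE addsmxSr addsmx_sub negb_and gF.
Qed.

(** Rank-nullity for [v |-> v *m F^T], which is surjective as [F] has full row rank. *)
Lemma dim_annihilator r (F : 'M[k]_(r, n)) (U : {vspace 'rV[k]_n}) :
  row_free F -> (forall v, v \in U <-> v *m F^T = 0) -> (\dim U + r = n)%N.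
Proof.
move=> Ffree UE; pose f := linfun (mulmxr F^T : 'rV[k]_n -> 'rV[k]_r).
have -> : U = lker f.
  apply/vspaceP => v; rewrite memv_ker lfunE /=; apply/idP/eqP => /UE //.
have full : (fullv <= f @: fullv)%VS.
  apply/subvP => w _; apply/memv_imgP; exists (w *m pinvmx F^T); first exact: memvf.
  rewrite lfunE /= mulmxKpV // submx_full // /row_full mxrank_tr.
  exact: Ffree.
have := limg_ker_dim f fullv; rewrite capfv.
have /eqP -> : (f @: fullv == fullv)%VS by rewrite eqEsubv subvf full.
by rewrite !dimvf !dim_matrix ![(_ * _)%R]mul1n.
Qed.

End LinearAlgebra.

Section DescendDerivation.
Variables (k : fieldType) (n : nat) (A : comAlgType k).
Variables (pi : {lrmorphism {mpoly k[n]} -> A}).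
Hypothesis pi_surj : forall a, exists p, pi p = a.

Lemma descend_derivation (w : 'I_n -> {mpoly k[n]}) :
  let D p := \sum_i p^`M(i) * w i in
  (forall p, pi p = 0 -> pi (D p) = 0) ->
  exists eta : derivation A, forall p, eta (pi p) = pi (D p).
Proof.
move=> D D0; have [lift liftK] := choice pi_surj.
have D_lin c p q : D (c *: p + q) = c *: D p + D q.
  rewrite /D scaler_sumr -big_split; apply: eq_bigr => i _ /=.
  by rewrite mderivD mderivZ mulrDl scalerAl.
have D_mul p q : D (p * q) = D p * q + p * D q.
  rewrite /D mulr_suml mulr_sumr -big_split; apply: eq_bigr => i _ /=.
  by rewrite mderivM; ring.
have piD p q : pi p = pi q -> pi (D p) = pi (D q).
  move=> pq; apply/eqP; rewrite -subr_eq0 -rmorphB /=.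
  have -> : D p - D q = D (- 1 *: q + p) by rewrite D_lin scaleN1r addrC.
  by rewrite D0 // rmorphD /= linearZ /= scaleN1r pq addNr.
have lin c f g : pi (D (lift (c *: f + g))) =
    c *: pi (D (lift f)) + pi (D (lift g)).
  rewrite -linearZ -rmorphD /= -D_lin; apply: piD.
  by rewrite liftK rmorphD /= linearZ /= !liftK.
have leib f g : pi (D (lift (f * g))) =
    pi (D (lift f)) * g + f * pi (D (lift g)).
  rewrite -{2}(liftK g) -{3}(liftK f) -!rmorphM -rmorphD /= -D_mul; apply: piD.
  by rewrite liftK rmorphM /= !liftK.
by exists (Derivation lin leib) => p; apply: piD; rewrite liftK.
Qed.

End DescendDerivation.

Section CoordinateRing.
Variables (k : closedFieldType) (n : nat) (X : set 'rV[k]_n).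
Hypotheses (X_irr : irreducible_closed X) (X_smooth : smooth X).
Variables (A : comAlgType k) (pi : {lrmorphism {mpoly k[n]} -> A}).
Hypothesis A_coord : is_coordinate_ring X pi.

Lemma pi_eq0P p : pi p = 0 <-> forall x, X x -> p.@[x ord0] = 0.
Proof. by case: A_coord => _ /(_ p). Qed.

(** If [p * q] vanishes on [X], then [X] is the union of its closed subsets [p = 0] and [q = 0], and
    irreducibility makes one of them all of [X]. *)
Lemma coordinate_ring_domain (a b : A) : a * b = 0 -> a = 0 \/ b = 0.
Proof.
have [surj _] := A_coord; have [p <-] := surj a; have [q <-] := surj b.
rewrite -rmorphM => /pi_eq0P pq0; have [[S XE] _ irr] := X_irr.
pose Y (r : {mpoly k[n]}) := zero_locus (S `|` [set r]).
have YE r x : Y r x <-> X x /\ r.@[x ord0] = 0.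
  rewrite XE /Y; split=> [Yx|[Sx rx] p' [/Sx//|->//]].
  split; last by apply: Yx; right.
  by move=> p' Sp'; apply: Yx; left.
have Yclosed r : zariski_closed (Y r) by exists (S `|` [set r]).
have XU : X = Y p `|` Y q.
  rewrite predeqE => x; split=> [Xx|[]/YE[]//].
  have /eqP := pq0 x Xx; rewrite mevalM mulf_eq0 => /orP[]/eqP ?.
    by left; apply/YE.
  by right; apply/YE.
have [XY|XY] := irr _ _ (Yclosed p) (Yclosed q) XU.
  by left; apply/pi_eq0P => x; rewrite XY => /YE[].
by right; apply/pi_eq0P => x; rewrite XY => /YE[].
Qed.

Definition gradient (p : {mpoly k[n]}) (y : 'I_n -> k) : 'rV[k]_n :=
  \row_i p^`M(i).@[y].

(** The gradients at [x] of the functions vanishing on [X] span the conormal space, whose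
    annihilator is the tangent space. Smoothness fixes the dimension [d] of the latter, so the rank
    is [n - d] at every point. *)
Lemma gradient_rank : exists r, forall x, X x ->
  exists F : 'M[k]_(r, n),
    [/\ forall i, exists2 p, pi p = 0 & gradient p (x ord0) = row i F,
        row_free F & forall p, pi p = 0 -> (gradient p (x ord0) <= F)%MS].
Proof.
have [d _ dimT] := X_smooth.
exists (n - d)%N => x Xx; have [U dimU UE] := dimT x Xx.
pose G := [set g | exists2 p, pi p = 0 & gradient p (x ord0) = g].
have [r [F [FG Ffree FS]]] := maximal_row_free G.
have <- : r = (n - d)%N.
  rewrite -(dim_annihilator (U := U) Ffree) => [|v]; first by rewrite dimU addKn.
  have gradE p : (v *m (gradient p (x ord0))^T) 0 0 =
      \sum_(i < n) meval_pt p^`M(i) x * v ord0 i.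
    by rewrite mxE; apply: eq_bigr => i _; rewrite !mxE mulrC.
  split=> [/UE vT|vF].
    apply/rowP => i; rewrite [RHS]mxE; have [p /pi_eq0P p0 pE] := FG i.
    transitivity ((v *m (gradient p (x ord0))^T) 0 0).
      by rewrite pE !mxE; apply: eq_bigr => j _; rewrite !mxE.
    by rewrite gradE; apply: vT.
  apply/UE => p /pi_eq0P p0; rewrite -gradE.
  have /submxP[c ->] : (gradient p (x ord0) <= F)%MS by apply: FS; exists p.
  by rewrite trmx_mul mulmxA vF mul0mx mxE.
exists F; split=> // p p0; by apply: FS; exists p.
Qed.

(* The columns of [P = det(FW) - W adj(FW) F], where [F] is the Jacobian matrix
   of functions in [I(X)] whose gradients span the conormal space at [x] and
   [F(x) W = 1], satisfy [F P = 0]; as the rank of the conormal space is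
   constant on [X], they are tangent to [X] wherever [det(FW) <> 0], hence
   everywhere. *)
Lemma euler_fields (x : 'rV[k]_n) : X x ->
  let s i := pi ('X_i - (x ord0 i)%:MP) in
  exists delta : 'I_n -> derivation A, forall i,
    ideal_power s 2 (\sum_j s j * delta j (s i) - s i).
Proof.
move=> Xx s; have [pi_surj _] := A_coord.
have [r rankX] := gradient_rank.
have [F0 [F0p F0free _]] := rankX x Xx.
have /choice[f /all_and2[f0 fE]] : forall i, exists p,
    pi p = 0 /\ gradient p (x ord0) = row i F0.
  by move=> i; have [p] := F0p i; exists p.
pose W := pinvmx F0.
pose J : 'M[{mpoly k[n]}]_(r, n) := \matrix_(i, j) (f i)^`M(j).
pose Q := J *m map_mx (@mpolyC n k) W.
pose P := (\det Q)%:M - map_mx (@mpolyC n k) W *m \adj Q *m J.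
have JP : J *m P = 0.
  by rewrite mulmxBr !mulmxA mul_mx_adj scalar_mxC subrr.
have evW y : map_mx (meval y) (map_mx (@mpolyC n k) W) = W.
  by apply/matrixP => i j; rewrite !mxE mevalC.
have evQ y : map_mx (meval y) Q = map_mx (meval y) J *m W.
  by rewrite map_mxM /= evW.
have rowJ y i : row i (map_mx (meval y) J) = gradient (f i) y.
  by apply/rowP => j; rewrite !mxE.
have Jx : map_mx (meval (x ord0)) J = F0.
  by apply/row_matrixP => i; rewrite rowJ fE.
have Qx : map_mx (meval (x ord0)) Q = 1%:M by rewrite evQ Jx mulmxVp.
have Px : map_mx (meval (x ord0)) P = 1%:M - W *m F0.
  rewrite map_mxB map_scalar_mx /= -det_map_mx Qx map_mxM map_mxM map_mx_adj Qx.
  by rewrite /= evW Jx det1 adj1 mulmx1.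
have evD p j y : (\sum_i p^`M(i) * P i j).@[y] =
    (gradient p y *m map_mx (meval y) P) 0 j.
  by rewrite mxE rmorph_sum; apply: eq_bigr => i _ /=; rewrite mevalM !mxE.
have tangentP p j : pi p = 0 -> pi (\sum_i p^`M(i) * P i j) = 0.
  (* [\det Q] is 1 at [x], hence nonzero in the domain [A]; after multiplying by it, only points
     where it does not vanish matter. *)
  move=> p0; suff : pi (\det Q) * pi (\sum_i p^`M(i) * P i j) = 0.
    case/coordinate_ring_domain => // /pi_eq0P/(_ x Xx)/eqP.
    by rewrite -det_map_mx Qx det1 oner_eq0.
  rewrite -rmorphM; apply/pi_eq0P => y Xy; rewrite mevalM evD -det_map_mx evQ.
  set Jy := map_mx _ J; have [->|det0] := eqVneq (\det (Jy *m W)) 0.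
    by rewrite mul0r.
  (* Invertibility of [Jy *m W] gives [Jy] full rank, so its rows span the conormal space at [y].
     The gradient of [p] is then a combination of them, which [P] kills. *)
  have Jy_free : row_free Jy.
    rewrite /row_free eqn_leq rank_leq_row /=.
    apply: leq_trans (mxrankM_maxl _ W); rewrite mxrank_unit //.
    by rewrite unitmxE unitfE.
  have [F [_ Ffree FS]] := rankX y Xy.
  have JF : (Jy <= F)%MS by apply/row_subP => i; rewrite rowJ; apply: FS.
  have FJ : (F <= Jy)%MS.
    by rewrite -(geq_leqif (mxrank_leqif_sup JF)) (eqP Ffree) (eqP Jy_free).
  have /submxP[c ->] := submx_trans (FS p p0) FJ.
  by rewrite -mulmxA -map_mxM JP map_mx0 mulmx0 mxE mulr0.
have /choice[delta deltaE] j := descend_derivation pi_surj (fun p => @tangentP p j).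
exists delta => i; have id2 := ideal_power_ideal s 2.
have delta_s j : delta j (s i) = pi (P i j).
  rewrite deltaE (bigD1 i) //= big1 => [|l li].
    rewrite mderivB mderivC subr0 mderivX mnm1E eqxx scale1r addr0.
    have -> : (U_(i) - U_(i) = 0)%MM by apply/mnmP => l; rewrite mnmBE subnn mnm0E.
    by rewrite mpolyX0 mul1r.
  rewrite mderivB mderivC subr0 mderivX mnm1E eq_sym (negPf li) scale0r.
  by rewrite mul0r.
have [c cE] : exists c : {rmorphism k -> A}, forall a, c a = pi a%:MP.
  by exists (GRing.RMorphism.clone k A (pi \o @mpolyC n k) _).
(* Up to sign, this is the Taylor remainder of [f a], which is zero in [A] and at [x]. *)
have conormal a : ideal_power s 2 (\sum_j c (F0 a j) * s j).
  have -> : \sum_j c (F0 a j) * s j =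
      - (pi (f a) - pi ((f a).@[x ord0])%:MP
         - \sum_j pi ((f a)^`M(j).@[x ord0])%:MP * s j).
    have /pi_eq0P/(_ x Xx)-> := f0 a.
    rewrite f0 mpolyC0 rmorph0 subrr sub0r opprK.
    by apply: eq_bigr => j _; rewrite cE -Jx !mxE.
  exact: (idealN id2 (taylor_order2 pi (x ord0) (f a))).
(* Since [P] is [1 - W *m F0] at [x], freezing its entries there gives [s i] minus a combination of
   conormal terms. What is left is [s j] times a function vanishing at [x]. *)
have -> : \sum_j s j * delta j (s i) - s i =
    \sum_j s j * (pi (P i j) - c (P i j).@[x ord0])
    - \sum_a c (W i a) * \sum_j c (F0 a j) * s j.
  have PxE j : (P i j).@[x ord0] = (i == j)%:R - \sum_a W i a * F0 a j.
    by move/matrixP/(_ i j): Px; rewrite !mxE => ->.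
  have sE : s i = \sum_j s j * c (P i j).@[x ord0] +
      \sum_a c (W i a) * \sum_j c (F0 a j) * s j.
    under [X in _ + X]eq_bigr do rewrite mulr_sumr.
    rewrite exchange_big -big_split /=.
    under eq_bigr => j _.
      rewrite PxE rmorphB rmorph_nat rmorph_sum mulrBr mulr_sumr.
      under [X in _ - X]eq_bigr do rewrite rmorphM mulrC -mulrA.
      rewrite subrK; over.
    rewrite (bigD1 i) //= eqxx mulr1 big1 ?addr0 // => j.
    by rewrite eq_sym => /negPf->; rewrite mulr0.
  rewrite {2}sE opprD addrA; congr (_ - _); rewrite -sumrB.
  by apply: eq_bigr => j _; rewrite delta_s mulrBr.
apply: (idealB id2); apply: (ideal_sum id2) => j _; last first.
  exact: (idealMl id2).
apply: (ideal_powerM (N := 1) (M := 1)); first exact: ideal_power_gen.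
have id1 := ideal_power_ideal s 1.
rewrite cE -[_ - _](subrK (\sum_l pi ((P i j)^`M(l).@[x ord0])%:MP * s l)).
apply: (idealD id1).
  exact/ideal_powerS/(taylor_order2 pi (x ord0) (P i j)).
by apply: (ideal_sum id1) => l _; apply/(idealMl id1)/ideal_power_gen.
Qed.

End CoordinateRing.

(** * Simplicity of the coordinate ring *)

Section Simplicity.
Variables (k : closedFieldType) (n : nat) (X : set 'rV[k]_n).
Hypotheses (X_irr : irreducible_closed X) (X_smooth : smooth X).
Variables (A : comAlgType k) (pi : {lrmorphism {mpoly k[n]} -> A}).
Hypothesis A_coord : is_coordinate_ring X pi.

(** Apply the weak Nullstellensatz to the coordinate functions. The point lies on [X] because the
    equations of [X] become 0 in [A], hence belong to [I]. *)
Lemma proper_ideal_point (I : set A) : is_ideal I -> ~ I 1 ->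
  exists2 x, X x & forall p, I (pi p) -> p.@[x ord0] = 0.
Proof.
move=> idI I1; pose c := GRing.RMorphism.clone k A (pi \o @mpolyC n k) _.
have piE : mmap c (fun i => pi 'X_i) =1 pi.
  apply: (@mpoly_rmorph_ext _ _ _ (mmap c _) pi) => [a|i] /=.
    by rewrite mmapC.
  by rewrite mmapX mmap1U.
have [x xI] := weak_nullstellensatz c (fun i => pi 'X_i) idI I1.
have xI' p : I (pi p) -> p.@[(\row_i x i) ord0] = 0.
  rewrite -piE => /xI <-; apply: meval_eq => i; by rewrite mxE.
exists (\row_i x i) => //; have [[S XE] _ _] := X_irr.
rewrite XE => p Sp; apply: xI'; suff -> : pi p = 0 by exact: ideal0.
by apply/(pi_eq0P A_coord) => y; rewrite XE; apply.
Qed.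

Lemma derivation_simple (I : set A) : [pchar k] =i pred0 ->
  is_ideal I -> derivation_stable I -> (exists2 f, f != 0 & I f) -> I 1.
Proof.
move=> char0 idI stI [f f0 If]; apply: contrapT => I1.
have [x Xx xI] := proper_ideal_point idI I1.
have [pi_surj _] := A_coord.
pose s i := pi ('X_i - (x ord0 i)%:MP).
have [delta deltaP] := euler_fields X_irr X_smooth A_coord Xx.
have I_s1 : I `<=` ideal_power s 1.
  move=> g; have [p <-] := pi_surj g => Ip; have id1 := ideal_power_ideal s 1.
  rewrite -[pi p](subrK (\sum_i pi (p^`M(i).@[x ord0])%:MP * s i)).
  apply: (idealD id1).
    have := taylor_order2 pi (x ord0) p; rewrite xI // mpolyC0 rmorph0 subr0.
    exact: ideal_powerS.
  by apply: (ideal_sum id1) => i _; apply/(idealMl id1)/ideal_power_gen.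
have IN := stable_sub_ideal_power deltaP char0 stI I_s1.
have fN N : ideal_power s N f by exact: IN.
pose m := [set a | exists2 p, p.@[x ord0] = 0 & pi p = a].
have idm : is_ideal m.
  split; first by exists 0; rewrite ?meval0 ?rmorph0.
  move=> a _ _ [p p0 <-] [q q0 <-]; have [r <-] := pi_surj a.
  exists (r * p + q); first by rewrite mevalD mevalM p0 q0 mulr0 addr0.
  by rewrite rmorphD rmorphM.
have ms i : m (s i).
  by exists ('X_i - (x ord0 i)%:MP); rewrite // mevalB mevalXU mevalC subrr.
have noA : noetherian A.
  apply: (noetherian_surj (f := pi)) => //.
  exact/noetherian_mpoly/noetherian_field.
(* Now [(1 - u) * f = 0] where [1 - u] takes the value 1 at [x], which contradicts [f != 0] in a
   domain. *)
have [u [p p0 pu] fu] := krull_intersection idm ms noA fN.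
have /(coordinate_ring_domain X_irr A_coord)[u1|/eqP] : (1 - u) * f = 0.
- by rewrite mulrBl mul1r -fu subrr.
- have : pi (1 - p) = 0 by rewrite rmorphB rmorph1 /= pu.
  move=> /(pi_eq0P A_coord)/(_ x Xx)/eqP.
  by rewrite mevalB meval1 p0 subr0 oner_eq0.
- by apply/negP.
Qed.

End Simplicity.

Theorem proposition1p2 (k : closedFieldType) (char0 : [pchar k] =i pred0)
    (n : nat) (X : set 'rV[k]_n)
    (X_irr : irreducible_closed X) (X_smooth : smooth X)
    (A : comAlgType k) (pi : {lrmorphism {mpoly k[n]} -> A})
    (A_coord : is_coordinate_ring X pi)
    (M : lmodType A) (act : derivation A -> M -> M)
    (M_AV : is_AV_module act) (M_fin : finitely_generated M) :
  projective M /\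
  [set m : M | exists f : A, f != 0 /\ f *: m = 0] = [set 0].
Proof.
have domA := coordinate_ring_domain X_irr A_coord.
have [a a0 Ma] := finitely_generated_generically_free domA M_fin.
have M1 : factors_through_free M 1.
  apply: (derivation_simple X_irr X_smooth A_coord char0).
  - exact: factors_through_free_ideal.
  - exact: factors_through_free_stable M_AV.
  - by exists a.
split; first exact: dual_basis_projective.
rewrite predeqE => m; split=> [[f [/eqP f0 fm0]]|->] /=.
  by apply: (dual_basis_torsionfree _ M1 fm0) => b /domA[].
by exists 1; rewrite oner_neq0 scaler0.
Qed.
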